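(* Let $k\geq 2$ and $n>6k^{2}$ be integers, and let $G$ be a graph of order $n$. If $q(G)\geq n+2k-2$, then $G$ contains a cycle of length $2k+1$ and a cycle of length $2k+2$ (as subgraphs).
   Context: All graphs are finite and simple. For a graph $G$, the signless Laplacian is $Q(G)=D(G)+A(G)$, where $D(G)$ is the diagonal matrix of vertex degrees and $A(G)$ is the adjacency matrix; $q(G)$ denotes the largest eigenvalue of $Q(G)$. *)

(* Defs.v *)
From HB Require Import structures.
From mathcomp Require Import all_boot all_order all_algebra.
Set Implicit Arguments. Unset Strict Implicit. Unset Printing Implicit Defensive.
Import Order.TTheory GRing.Theory Num.Theory.
Local Open Scope ring_scope.

Definition simple_graph (n : nat) (e : rel 'I_n) : Prop :=
  symmetric e /\ irreflexive e.

Definition deg (n : nat) (e : rel 'I_n) (i : 'I_n) : nat := #|[set j | e i j]|.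

Definition adjmx (R : nzRingType) (n : nat) (e : rel 'I_n) : 'M[R]_n :=
  \matrix_(i, j) (e i j)%:R.
Definition degmx (R : nzRingType) (n : nat) (e : rel 'I_n) : 'M[R]_n :=
  diag_mx (\row_i (deg e i)%:R).
Definition signless_laplacian (R : nzRingType) (n : nat) (e : rel 'I_n) : 'M[R]_n :=
  degmx R e + adjmx R e.

Definition largest_eigenvalue (R : numFieldType) (n : nat) (M : 'M[R]_n) (q : R) : Prop :=
  eigenvalue M q /\ forall a : R, eigenvalue M a -> a <= q.

Definition has_cycle_of_length (n : nat) (e : rel 'I_n) (L : nat) : Prop :=
  exists s : seq 'I_n, [/\ cycle e s, uniq s & size s = L].

(* Main.v *)
Require Import Defs.
From HB Require Import structures.
From mathcomp Require Import all_boot all_order all_algebra.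
From mathcomp Require Import zify.
Import Order.TTheory GRing.Theory Num.Theory.
Set Implicit Arguments. Unset Strict Implicit. Unset Printing Implicit Defensive.

(* For positive weights [y], an eigenvalue [q >= N] of [Q] forces [Q y >= N y] at
   some vertex, with equality propagating to its neighbours if [Q y <= N y]
   everywhere.  Take [N = n + 2k - 2] and first [y = deg].  For a vertex [v] of
   degree [d] with [U = N(v)] and [W] the set of its non-neighbours,
   [(Q deg)_v = d^2 + d + 2 e(U) + e(U, W)], which is at least [N d] only if
   [2 e(U)] is at least [2k - 2] times [d] plus the number of non-edges between
   [U] and [W].

   If there is no cycle of length [2k + 1], then [U] has no path on [2k] vertices,
   so [2 e(U) <= (2k - 2) d] by Erdős--Gallai.  In the case of equality [U] is
   completely joined to [W], hence [W] is small, for [v] and all its neighbours;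
   this makes [U] too dense.

   If there is no cycle of length [2k + 2], then [U] has no path on [2k + 1]
   vertices, so [2 e(U) <= (2k - 1) d], and neither has [U] plus a non-neighbour
   [w] with many neighbours in [U].  This rules out everything but a (nearly)
   dominating [v].  Such a [v] can exceed [N d] only because of components of
   [G[U]] on [2k] vertices; replacing the weights by [2] there gives
   [Q y < N y] at every vertex. *)

(** * Paths and degrees inside a vertex set *)

Section Paths.

Variables (T : finType) (e : rel T).
Hypotheses (e_sym : symmetric e) (e_irr : irreflexive e).
Implicit Types X Y S : {set T}.

Definition upath (X : {set T}) (s : seq T) :=
  [&& uniq s, sorted e s & all [in X] s].

(** A sum of booleans, so that double counting is an exchange of sums; summed over [v] in [X], it is
    twice the number of edges inside [X]. *)
Definition degin (X : {set T}) (v : T) : nat := \sum_(w in X) e v w.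

Lemma degin_card X v : degin X v = #|[set w in X | e v w]|.
Proof.
rewrite /degin -sum1_card big_mkcond [RHS]big_mkcond /=.
by apply: eq_bigr => w _; rewrite inE; case: (w \in X); case: (e v w).
Qed.

Lemma degin_le_card X v : degin X v <= #|X|.
Proof.
rewrite degin_card; apply/subset_leq_card/subsetP => w.
by rewrite inE => /andP[].
Qed.

Lemma sum_degin_le X Y : \sum_(v in X) degin Y v <= #|X| * #|Y|.
Proof. by rewrite -sum_nat_const; apply: leq_sum => v _; apply: degin_le_card. Qed.

Lemma degin_lt_card X v : v \in X -> degin X v < #|X|.
Proof.
move=> vX; rewrite degin_card; apply/proper_card/properP; split.
  by apply/subsetP => w; rewrite inE => /andP[].
by exists v; rewrite // inE e_irr andbF.
Qed.

Lemma degin_full X v : #|X| <= degin X v -> forall w, w \in X -> e v w.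
Proof.
rewrite degin_card => cX w wX.
have /eqP/setP/(_ w) : [set w in X | e v w] == X.
  by rewrite eqEcard cX andbT; apply/subsetP => z; rewrite inE => /andP[].
by rewrite inE wX.
Qed.

Lemma degin_disjointU X Y v :
  [disjoint X & Y] -> degin (X :|: Y) v = degin X v + degin Y v.
Proof. by move=> dXY; rewrite /degin -bigU //; apply: eq_bigl => w; rewrite inE. Qed.

Lemma degin_setU1 X v w : w \notin X -> degin (w |: X) v = e v w + degin X v.
Proof. by move=> wX; rewrite /degin big_setU1. Qed.

Lemma degin_subset X Y v : X \subset Y -> degin X v <= degin Y v.
Proof.
move=> /subsetP XY; rewrite !degin_card; apply/subset_leq_card/subsetP => w.
by rewrite !inE => /andP[/XY-> ->].
Qed.

Lemma exchange_degin X Y :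
  \sum_(x in X) degin Y x = \sum_(y in Y) degin X y.
Proof.
rewrite /degin exchange_big /=; apply: eq_bigr => y _.
by apply: eq_bigr => x _; rewrite e_sym.
Qed.

Lemma sum_degin_setU1 X w : w \notin X ->
  \sum_(v in w |: X) degin (w |: X) v
    = \sum_(v in X) degin X v + (degin X w).*2.
Proof.
move=> wX; rewrite big_setU1 //= degin_setU1 // e_irr add0n.
under eq_bigr do rewrite degin_setU1 //.
rewrite big_split /= [X in _ + (X + _)](_ : _ = degin X w); first by lia.
by apply: eq_bigr => v _; rewrite e_sym.
Qed.

Lemma upath_rev X s : upath X (rev s) = upath X s.
Proof.
rewrite /upath rev_uniq all_rev rev_sorted; congr [&& _, _ & _].
by apply: eq_sorted => x y; rewrite e_sym.
Qed.

Lemma upath_take X s m : upath X s -> upath X (take m s).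
Proof.
case/and3P=> us ss Xs; apply/and3P; split; first exact: take_uniq.
  exact: take_sorted.
by apply/allP => x /mem_take; apply/allP.
Qed.

Lemma upath_sub X Y s : upath X s -> {subset s <= Y} -> upath Y s.
Proof. by case/and3P=> us ss _ sY; rewrite /upath us ss; apply/allP. Qed.

Lemma upath_size X s : upath X s -> size s <= #|X|.
Proof.
case/and3P=> us _ /allP Xs; rewrite -(card_uniqP us).
by apply/subset_leq_card/subsetP.
Qed.

Lemma upath_subset X Y s : X \subset Y -> upath X s -> upath Y s.
Proof.
move=> /subsetP XY us; apply: upath_sub (us) _ => x xs.
by case/and3P: us => _ _ /allP/(_ x xs)/XY.
Qed.

Lemma upath_cons X v x s : v \in X -> v \notin x :: s -> e v x ->
  upath X (x :: s) -> upath X (v :: x :: s).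
Proof.
move=> vX vs evx /and3P[us ss Xs]; apply/and3P; split.
- by rewrite cons_uniq vs.
- by rewrite /= evx.
- by rewrite /= vX.
Qed.

Lemma upath_cycle_rot X c x : cycle e c -> uniq c -> {subset c <= X} ->
  x \in c -> exists s, [/\ upath X (x :: s) & perm_eq (x :: s) c].
Proof.
move=> cc uc cX xc; case/rot_to: (xc) => i s def_s; exists s.
have per : perm_eq (x :: s) c by rewrite -def_s perm_rot.
split=> //; rewrite /upath (perm_uniq per) uc (perm_all _ per) /=.
rewrite (_ : all _ c) ?andbT; last by apply/allP.
by move: cc; rewrite -(rot_cycle i) def_s /= rcons_path => /andP[].
Qed.

(** Pigeonhole over the [size p] pairs of consecutive entries: [a] is counted on first entries, [b]
    on second ones. *)
Lemma crossing_pair (a b : pred T) x p :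
  size p < count a (belast x p) + count b p ->
  exists s1 c d s2, [/\ x :: p = rcons s1 c ++ d :: s2, a c & b d].
Proof.
elim: p x => [|y p IH] x //=.
case: (boolP (a x && b y)) => [/andP[ax by_] _|nab lt].
  by exists [::], x, y, p.
have /IH[s1 [c [d [s2 [eq_s ac bd]]]]] :
    size p < count a (belast y p) + count b p.
  by move: nab lt; case: (a x); case: (b y) => //=; lia.
by exists (x :: s1), c, d, s2; rewrite eq_s.
Qed.

Lemma degin_le_count X v s :
  (forall w, w \in X -> e v w -> w \in s) -> degin X v <= count (e v) s.
Proof.
move=> sub; rewrite degin_card -size_filter -(card_in_imset (f := id)) //.
apply: leq_trans (card_size _); apply/subset_leq_card/subsetP => w.
by rewrite imset_id inE mem_filter => /andP[wX evw]; rewrite evw sub.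
Qed.

(* Pósa--Dirac: reverse the part of the path after a pair of consecutive vertices
   [c, d] such that [c] is adjacent to the last and [d] to the first vertex. *)
Lemma close_path X x p :
  upath X (x :: p) ->
  (forall w, w \in X -> e x w -> w \in x :: p) ->
  (forall w, w \in X -> e (last x p) w -> w \in x :: p) ->
  size p < degin X x + degin X (last x p) ->
  exists c, [/\ cycle e c & perm_eq c (x :: p)].
Proof.
move=> /and3P[us ss _] nx ny lt.
have cx := degin_le_count nx; have cy := degin_le_count ny.
rewrite [in count _ _]lastI -cats1 count_cat /= e_irr !addn0 in cy.
rewrite /= e_irr add0n in cx.
have /crossing_pair[s1 [c [d [s2 [eq_s ac bd]]]]] :
  size p < count (e (last x p)) (belast x p) + count (e x) p by lia.
exists (rcons s1 c ++ rev (d :: s2)); split; last first.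
  by rewrite eq_s perm_cat2l perm_rev.
have lastE : last x p = last d s2.
  by rewrite -(last_cons x) eq_s last_cat last_rcons.
have s1E : exists s1', rcons s1 c = x :: s1'.
  by case: s1 eq_s => [|z s1] [-> _]; eexists.
case: s1E => s1' eq1; have lc : last x s1' = c.
  by rewrite -(last_cons x) -eq1 last_rcons.
rewrite eq1 /= in eq_s *; move: ss.
have -> : p = s1' ++ d :: s2 by case: eq_s.
rewrite /= cat_path /=.
case/and3P=> ps1 _ ps2; rewrite rcons_cat cat_path ps1 lc /=.
have : path e x (rcons (d :: s2) c) by rewrite /= bd rcons_path ps2 -lastE.
have -> : path e x (rcons (d :: s2) c) = path (fun u v => e v u) x (rcons (d :: s2) c).
  by apply: eq_path => u v; rewrite e_sym.
by rewrite -rev_path last_rcons belast_rcons [rev (x :: _)]rev_cons.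
Qed.

(** For [Y] inside [X]: a union of components of the graph induced on [X]. *)
Definition closed_in X Y := forall v w, v \in Y -> w \in X -> e v w -> w \in Y.

Definition starts_path X v m := exists s, upath X (v :: s) /\ size (v :: s) = m.

(* Extend a path at either end, or through a cycle on its vertex set, until
   nothing leaves it; this must stop before [2k + 1] vertices. *)
Lemma closed_traceable_set k X : 0 < k -> X != set0 ->
  (forall v, v \in X -> k <= degin X v) ->
  (forall s, upath X s -> size s != k.*2.+1) ->
  exists Y, [/\ Y \subset X, Y != set0, #|Y| <= k.*2, closed_in X Y
               & forall v, v \in Y -> starts_path Y v #|Y|].
Proof.
move=> k_gt0 /set0Pn[x0 x0X] dX noP.
have short s : upath X s -> size s <= k.*2.
  move=> us; rewrite leqNgt; apply/negP => lt.
  by have /negP[] := noP _ (upath_take k.*2.+1 us); rewrite size_takel.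
set goal := ex _; suff main m x p : upath X (x :: p) -> k.*2 - size p = m -> goal.
  by apply: (main _ x0 [::]) => //; rewrite /upath /= x0X.
elim: m x p => [|m IH] x p xpX szp.
  by have := short _ xpX; rewrite /=; lia.
have szs := short _ xpX; rewrite /= in szs.
have ext v y q : upath X (y :: q) -> size q = size p -> v \in X -> e y v ->
    v \notin y :: q -> goal.
  move=> yqX szq vX eyv vyq; apply: (IH v (y :: q)); last by rewrite /=; lia.
  by apply: upath_cons; rewrite // e_sym.
pose leaves y := [exists v, [&& v \in X, e y v & v \notin x :: p]].
have inS y : ~~ leaves y -> forall w, w \in X -> e y w -> w \in x :: p.
  move=> /existsPn h w wX eyw; move: (h w); rewrite wX eyw /=.
  by rewrite negbK.
have [/existsP[v /and3P[vX exv vxp]]|nx] := boolP (leaves x).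
  exact: (ext v x p).
have [/existsP[v /and3P[vX eyv vxp]]|ny] := boolP (leaves (last x p)).
  have := xpX; rewrite -upath_rev lastI rev_rcons => h; apply: (ext v) h _ vX eyv _.
    by rewrite size_rev size_belast.
  by rewrite -rev_rcons -lastI mem_rev.
have [us ss /allP sX] := and3P xpX.
(* Both ends keep their neighbours on the path, so their degrees in [X] sum to at least [2k], more
   than [size p]. *)
have [|c [cc pc]] := close_path xpX (inS _ nx) (inS _ ny).
  have := dX _ (sX _ (mem_head x p)); have := dX _ (sX _ (mem_last x p)).
  by move: szs; rewrite -addnn; move: (degin X x) (degin X (last x p)) => a b; lia.
have uc : uniq c by rewrite (perm_uniq pc).
have szc : size c = (size p).+1 by rewrite (perm_size pc).
have cX : {subset c <= X} by move=> v; rewrite (perm_mem pc) => /sX.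
have cardc : #|[set v in c]| = size c by rewrite cardsE; apply/card_uniqP.
have rotc v : v \in c -> exists s, [/\ upath X (v :: s) & perm_eq (v :: s) c].
  exact: upath_cycle_rot.
have [/existsP[v /andP[vc /existsP[w /and3P[wX evw wc]]]]|nc] :=
    boolP [exists v, (v \in c) && leaves v].
  have [s [vsX ps]] := rotc v vc; apply: (ext w v s) => //.
    by have := perm_size ps; rewrite szc; case.
  by rewrite (perm_mem ps) (perm_mem pc).
exists [set v in c]; split.
- by apply/subsetP => v; rewrite inE => /cX.
- by apply/set0Pn; exists x; rewrite inE (perm_mem pc) mem_head.
- by rewrite cardc szc.
- move=> v w; rewrite !inE => vc wX evw; rewrite (perm_mem pc).
  apply: inS wX evw; apply: contra nc => lv.
  by apply/existsP; exists v; rewrite vc.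
- move=> v; rewrite inE => vc; have [s [vsX ps]] := rotc v vc; exists s.
  rewrite cardc (perm_size ps); split=> //; apply: upath_sub vsX _ => w.
  by rewrite (perm_mem ps) inE.
Qed.

(** * Splitting off components: the Erdős-Gallai bounds *)

Lemma degin_setD X S v : S \subset X -> degin X v = degin S v + degin (X :\: S) v.
Proof. by move=> /setIidPr SX; rewrite /degin (big_setID S) /= SX. Qed.

Lemma degin_closed0 X S v :
  closed_in X S -> v \in X -> v \notin S -> degin S v = 0.
Proof.
move=> cl vX vS; rewrite /degin big1 // => w wS; case: (boolP (e v w)) => // evw.
by case/negP: vS; apply: cl wS vX _; rewrite e_sym.
Qed.

Lemma closed_in_setD X S : closed_in X S -> closed_in X (X :\: S).
Proof.
move=> cl v w; rewrite !inE => /andP[vS vX] wX evw; rewrite wX andbT.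
by apply: contra vS => wS; apply: cl wS vX _; rewrite e_sym.
Qed.

Lemma sum_degin_closed X S : S \subset X -> closed_in X S ->
  \sum_(v in X) degin X v =
    \sum_(v in S) degin S v + \sum_(v in X :\: S) degin (X :\: S) v.
Proof.
move=> SX cl; rewrite (big_setID S) /= (setIidPr SX); congr (_ + _).
  apply: eq_bigr => v vS; rewrite (degin_setD _ SX).
  rewrite [X in _ + X](degin_closed0 (closed_in_setD cl)) ?addn0 //.
    exact: (subsetP SX).
  by rewrite inE vS.
apply: eq_bigr => v; rewrite inE => /andP[vS vX].
by rewrite (degin_setD _ SX) (degin_closed0 cl).
Qed.

(* Erdős--Gallai refined: only the vertices of "full" components of order [2k]
   can push the average degree above [2k - 2]. *)
Lemma path_free_partition k X : 1 < k ->
  (forall s, upath X s -> size s != k.*2.+1) ->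
  exists S, [/\ S \subset X, closed_in X S,
    forall v, v \in S -> degin S v < k.*2,
    forall v, v \in S -> starts_path S v k.*2
    & \sum_(v in X :\: S) degin (X :\: S) v <= (k.*2 - 2) * #|X :\: S|].
Proof.
move=> k_gt1; move: {2}#|X| (leqnn #|X|) => m.
elim: m X => [|m IH] X; rewrite ?leqn0.
  rewrite cards_eq0 => /eqP-> _; exists set0.
  by split; rewrite ?sub0set ?setD0 ?big_set0 // => v; rewrite inE.
move=> Xm noP; have [X0|X0] := eqVneq X set0.
  by apply: IH noP; rewrite X0 cards0.
have sub Y : Y \subset X -> forall s, upath Y s -> size s != k.*2.+1.
  by move=> YX s us; apply: noP; apply: upath_subset us.
(* A vertex of degree below [k] can be removed: putting it back adds at most [2k - 2] to the degree
   sum. *)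
have [/existsP[v /andP[vX dv]]|lowN] := boolP [exists v, (v \in X) && (degin X v < k)].
  have [||S [SX cl dS pS eS]] := IH (X :\ v).
  - by rewrite (cardsD1 v) vX in Xm.
  - by apply: sub; apply: subD1set.
  have vS : v \notin S by apply/negP => /(subsetP SX); rewrite !inE eqxx.
  (* An edge from [v] to [w] would prolong a path on [2k] vertices starting at [w]. *)
  have vSN w : w \in S -> ~~ e v w.
    move=> wS; apply/negP => evw; have [s [us szs]] := pS w wS.
    suff /noP : upath X [:: v, w & s] by rewrite -szs eqxx.
    apply: upath_cons => //.
      apply/negP => vs; case/and3P: us => _ _ /allP/(_ v vs).
      by rewrite (negPf vS).
    apply: upath_sub (us) _ => z zs; case/and3P: us => _ _ /allP/(_ z zs).
    by move/(subsetP SX); rewrite inE => /andP[].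
  have DE : X :\: S = v |: ((X :\ v) :\: S).
    by apply/setP => z; rewrite !inE; case: eqVneq => [->|]; rewrite ?vS ?vX.
  have vD : v \notin (X :\ v) :\: S by rewrite !inE eqxx andbF.
  exists S; split=> //.
  - by apply: subset_trans SX (subD1set _ _).
  - move=> x w xS wX exw; apply: cl (xS) _ (exw); rewrite !inE wX andbT.
    by apply: contraTneq exw => ->; rewrite e_sym vSN.
  - rewrite DE sum_degin_setU1 // cardsU1 vD mulnDr muln1.
    have : degin ((X :\ v) :\: S) v <= degin X v.
      by apply: degin_subset; apply: subset_trans (subsetDl _ _) (subD1set _ _).
    by move: eS dv; lia.
(* All degrees are now at least [k], and a closed traceable [Y] is split off. With fewer than [2k]
   vertices its degrees are at most [2k - 2]; with exactly [2k] it joins [S]. *)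
have [||//|Y [YX Y0 Yk clY pY]] := @closed_traceable_set k X _ X0.
- by lia.
- move=> v vX; rewrite leqNgt; apply: contra lowN => dv.
  by apply/existsP; exists v; rewrite vX.
have [||S [SX cl dS pS eS]] := IH (X :\: Y).
- have : 0 < #|Y| by rewrite card_gt0.
  by have := cardsID Y X; rewrite (setIidPr YX); lia.
- by apply: sub; apply: subsetDl.
have degY v : v \in Y -> degin Y v < #|Y| by exact: degin_lt_card.
have SY : [disjoint S & Y].
  rewrite -setI_eq0; apply/eqP/setP => v; rewrite !inE; apply/negP => /andP[vS vY].
  by have := subsetP SX v vS; rewrite inE vY.
have clXS : closed_in X S.
  move=> v w vS wX evw; apply: cl (vS) _ (evw); rewrite inE wX andbT.
  apply/negP => wY; have := subsetP SX v vS; rewrite inE => /andP[/negP vY vX].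
  by apply: vY; apply: clY wY vX _; rewrite e_sym.
have SX' : S \subset X by apply: subset_trans SX (subsetDl _ _).
have YXS : Y \subset X :\: S by rewrite subsetD YX disjoint_sym.
have DE : (X :\: Y) :\: S = (X :\: S) :\: Y by rewrite !setDDl setUC.
have [Ylt|Yge] := ltnP #|Y| k.*2.
  exists S; split=> //.
  rewrite (@sum_degin_closed (X :\: S) Y) //; last first.
    by move=> v w vY; rewrite inE => /andP[_ wX]; apply: clY.
  rewrite -DE -(cardsID Y (X :\: S)) (setIidPr YXS) -DE mulnDr leq_add //.
  rewrite mulnC -sum_nat_const; apply: leq_sum => v /degY; lia.
have {Yge}Yk2 : #|Y| = k.*2 by apply/eqP; rewrite eqn_leq Yk.
exists (Y :|: S); split.
- by rewrite subUset YX.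
- move=> v w; rewrite !inE => /orP[vY|vS] wX evw; first by rewrite (clY v).
  by rewrite (clXS v) ?orbT.
- move=> v; rewrite inE degin_disjointU 1?disjoint_sym // => /orP[vY|vS].
    rewrite (degin_closed0 clXS) ?addn0 -?Yk2 ?degY ?(subsetP YX) //.
    by move: (disjointFl SY vY) => ->.
  by rewrite (degin_closed0 clY) ?(subsetP SX') ?dS //; rewrite (disjointFr SY vS).
- move=> v; rewrite inE => /orP[vY|vS].
    have [s [us szs]] := pY v vY; exists s; rewrite -Yk2; split=> //.
    exact: upath_subset (subsetUl _ _) us.
  have [s [us szs]] := pS v vS; exists s; split=> //.
  exact: upath_subset (subsetUr _ _) us.
- by rewrite -setDDl.
Qed.

Lemma Erdos_Gallai_odd k X : 1 < k ->
  (forall s, upath X s -> size s != k.*2.+1) ->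
  \sum_(v in X) degin X v <= (k.*2 - 1) * #|X|.
Proof.
move=> k_gt1 /(path_free_partition k_gt1)[S [SX cl dS _ eS]].
rewrite (sum_degin_closed SX cl) -(cardsID S X) (setIidPr SX) mulnDr.
apply: leq_add; last by apply: leq_trans eS _; rewrite leq_mul2r; apply/orP; right; lia.
by rewrite mulnC -sum_nat_const; apply: leq_sum => v /dS; lia.
Qed.

(** Every vertex of the dense part [S] starts a path on [2k] vertices, so here [S] is empty. *)
Lemma Erdos_Gallai_even k X : 1 < k ->
  (forall s, upath X s -> size s != k.*2) ->
  \sum_(v in X) degin X v <= (k.*2 - 2) * #|X|.
Proof.
move=> k_gt1 noP.
have [s us|S [SX cl _ pS eS]] := path_free_partition (X := X) k_gt1.
  apply/negP => /eqP szs; have := noP _ (upath_take k.*2 us).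
  by rewrite size_takel ?szs // eqxx.
suff S0 : S = set0 by rewrite S0 setD0 in eS.
apply/eqP/set0Pn => -[v /pS[s [us szs]]].
by have := noP _ (upath_subset SX us); rewrite szs eqxx.
Qed.

(** * Cycles from cones and from complete bipartite graphs *)

Lemma cone_cycle v x s :
  e v x -> e v (last x s) -> v \notin x :: s -> uniq (x :: s) -> path e x s ->
  cycle e (v :: x :: s) /\ uniq (v :: x :: s).
Proof.
move=> evx evl vs us ps; split; last by rewrite cons_uniq vs us.
by rewrite /= evx rcons_path ps e_sym evl.
Qed.

(** The path alternates between [m + 2] vertices of [A] and [m + 1] of [B]; the induction removes
    its first vertex in each class. *)
Lemma complete_bipartite_path m (A B : {set T}) a a' :
  [disjoint A & B] -> (forall x y, x \in A -> y \in B -> e x y) ->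
  a \in A -> a' \in A -> a != a' -> m.+1 < #|A| -> m < #|B| ->
  exists s, [/\ path e a s, last a s = a', uniq (a :: s), size s = m.+1.*2
              & {subset a :: s <= A :|: B}].
Proof.
elim: m A B a => [|m IH] A B a dAB full aA a'A aa' szA szB.
  have /card_gt0P[b bB] : 0 < #|B| by [].
  have ba : b != a by apply: contraTneq bB => ->; rewrite (disjointFr dAB aA).
  have ba' : b != a' by apply: contraTneq bB => ->; rewrite (disjointFr dAB a'A).
  exists [:: b; a']; split=> //=.
  - by rewrite full //= e_sym full.
  - by rewrite !inE negb_or eq_sym ba aa' ba'.
  - by move=> z; rewrite !inE => /or3P[] /eqP->; rewrite ?aA ?a'A ?bB ?orbT.
have /card_gt0P[b bB] : 0 < #|B| by apply: leq_trans szB.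
have /card_gt0P[a2] : 0 < #|A :\ a :\ a'|.
  by move: szA; rewrite (cardsD1 a) aA (cardsD1 a' (A :\ a)) !inE eq_sym aa' a'A; lia.
rewrite !inE => /and3P[a2a' a2a a2A].
have [|||||||s [ps ls us szs sub]] := IH (A :\ a) (B :\ b) a2 => //.
- apply: disjointWl (subD1set _ _) _.
  by rewrite disjoint_sym; apply: disjointWl (subD1set _ _) _; rewrite disjoint_sym.
- by move=> x y; rewrite !inE => /andP[_ xA] /andP[_ yB]; apply: full.
- by rewrite !inE a2a.
- by rewrite !inE eq_sym aa'.
- by move: szA; rewrite (cardsD1 a) aA.
- by move: szB; rewrite (cardsD1 b) bB.
have aB : a \notin B by rewrite (disjointFr dAB aA).
have bA : b \notin A by rewrite (disjointFl dAB bB).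
have ba : b != a by apply: contraTneq bB => ->.
exists [:: b, a2 & s]; split=> //=.
- by rewrite full //= e_sym full.
- rewrite in_cons negb_or eq_sym ba; apply/and3P; split=> //.
    by apply/negP => /sub; rewrite !inE eqxx (negPf aB) andbF.
  by apply/negP => /sub; rewrite !inE eqxx (negPf bA) andbF.
- by rewrite szs.
- move=> z; rewrite !inE => /or3P[/eqP->|/eqP->|zs]; rewrite ?aA ?bB ?orbT //.
  have := sub z; rewrite !inE zs => /(_ isT).
  by case/orP=> /andP[_ ->]; rewrite ?orbT.
Qed.

End Paths.

(** * The signless Laplacian on integer weights *)

Section SignlessLaplacian.

Variables (n : nat) (e : rel 'I_n).
Hypotheses (e_sym : symmetric e) (e_irr : irreflexive e).

Definition nbr v := [set w | e v w].

Definition far v := ~: (v |: nbr v).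

(** The action of [Q] on weights in [nat], which keeps the estimates in integer arithmetic. *)
Definition Qact (y : 'I_n -> nat) v := deg e v * y v + \sum_(w in nbr v) y w.

Section TestVector.

Local Open Scope ring_scope.

Lemma mul_signless_laplacian (R : nzRingType) (x : 'rV[R]_n) v :
  (x *m signless_laplacian R e) 0 v
    = x 0 v * (deg e v)%:R + \sum_(w in nbr v) x 0 w.
Proof.
rewrite /signless_laplacian mulmxDr mxE; congr (_ + _).
  by rewrite /degmx mul_mx_diag !mxE.
rewrite mxE [RHS]big_mkcond; apply: eq_bigr => w _.
by rewrite mxE inE e_sym; case: (e v w); rewrite ?mulr1 ?mulr0.
Qed.

(* Collatz--Wielandt: compare an eigenvector [x] with the weights [y] at the
   vertices where [`|x v| / y v] is maximal; equality there propagates to the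
   neighbours. *)
Lemma test_vector (R : realFieldType) (q : R) (N : nat) (y : 'I_n -> nat) :
  eigenvalue (signless_laplacian R e) q -> (0 < N)%N -> N%:R <= q ->
  (forall v, 0 < deg e v -> 0 < y v)%N ->
  (forall v, 0 < deg e v -> Qact y v <= N * y v)%N ->
  exists v, [/\ (0 < deg e v)%N, Qact y v = (N * y v)%N
              & forall w, e v w -> Qact y w = (N * y w)%N].
Proof.
move=> /eigenvalueP[x xQ x0] N0 Nq ypos Qy.
have q0 : 0 < q by apply: lt_le_trans Nq; rewrite ltr0n.
have eqx v : q * x 0 v = x 0 v * (deg e v)%:R + \sum_(w in nbr v) x 0 w.
  by rewrite -mul_signless_laplacian xQ mxE.
(* As [q > 0], an eigenvector vanishes at isolated vertices, where weights may be [0]. *)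
have iso v : deg e v = 0%N -> x 0 v = 0.
  move=> dv; have /eqP := eqx v; rewrite dv mulr0 add0r big1 => [|w].
    by rewrite mulf_eq0 gt_eqF //= => /eqP.
  by rewrite /nbr (cards0_eq dv) inE.
have [v1 xv1] : exists v, x 0 v != 0.
  by case/rV0Pn: x0 => v; exists v.
have dv1 : (0 < deg e v1)%N by rewrite lt0n; apply: contra xv1 => /eqP/iso->.
pose f v := `|x 0 v| / (y v)%:R.
pose v0 := [arg max_(v > v1 | (0 < deg e v)%N) f v]%O.
have [dv0 fmax] : (0 < deg e v0)%N /\ forall v, (0 < deg e v)%N -> f v <= f v0.
  by rewrite /v0; case: arg_maxP.
set r := f v0 in fmax.
have r0 : 0 < r.
  apply: lt_le_trans (fmax _ dv1); rewrite divr_gt0 ?normr_gt0 ?ltr0n //.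
  exact: ypos.
have le_x v : `|x 0 v| <= r * (y v)%:R.
  have [/iso->|dv] := posnP (deg e v); first by rewrite normr0 mulr_ge0 ?ler0n // ltW.
  by rewrite -ler_pdivrMr ?ltr0n ?ypos //; apply: fmax.
(* At a vertex of maximal ratio the triangle inequality gives [N * |x v| <= r * Qact y v]. Together
   with [Qact y v <= N * y v] this forces equality, term by term over the neighbours. *)
have key v : (0 < deg e v)%N -> `|x 0 v| = r * (y v)%:R ->
    Qact y v = (N * y v)%N /\ forall w, e v w -> `|x 0 w| = r * (y w)%:R.
  move=> dv xv.
  have le1 : N%:R * `|x 0 v| <= `|x 0 v| * (deg e v)%:R + \sum_(w in nbr v) `|x 0 w|.
    apply: (@le_trans _ _ `|q * x 0 v|).
      by rewrite normrM ler_wpM2r // ger0_norm // ltW.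
    rewrite eqx; apply: le_trans (ler_normD _ _) _.
    by rewrite normrM normr_nat lerD2l ler_norm_sum.
  have le2 : \sum_(w in nbr v) `|x 0 w| <= r * (\sum_(w in nbr v) y w)%:R.
    by rewrite natr_sum mulr_sumr ler_sum.
  have le3 : r * (Qact y v)%:R <= r * (N * y v)%:R.
    by rewrite ler_pM2l // ler_nat Qy.
  have QE : r * (Qact y v)%:R =
      `|x 0 v| * (deg e v)%:R + r * (\sum_(w in nbr v) y w)%:R.
    by rewrite /Qact natrD natrM mulrDr xv -[in RHS]mulrA [in RHS](mulrC (y v)%:R).
  have NE : r * (N * y v)%:R = N%:R * `|x 0 v| by rewrite natrM xv mulrCA.
  have eq3 : r * (Qact y v)%:R = r * (N * y v)%:R.
    by apply/le_anti; rewrite le3 NE QE (le_trans le1) // lerD2l.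
  split.
    by move/(mulfI (lt0r_neq0 r0)): eq3 => /eqP; rewrite eqr_nat => /eqP.
  have eq2 : \sum_(w in nbr v) (r * (y w)%:R - `|x 0 w|) = 0.
    apply/le_anti; rewrite sumr_ge0 ?andbT => [|w _]; last by rewrite subr_ge0.
    rewrite sumrB -mulr_sumr -natr_sum subr_le0.
    by rewrite -(lerD2l (`|x 0 v| * (deg e v)%:R)) -QE eq3 NE.
  move=> w evw; apply/esym/eqP; rewrite -subr_eq0; apply/eqP.
  by apply: (psumr_eq0P _ eq2) => [u _|]; rewrite ?subr_ge0 ?inE.
have xv0 : `|x 0 v0| = r * (y v0)%:R.
  by rewrite /r /f divfK // pnatr_eq0 -lt0n ypos.
have [Qv0 nv0] := key v0 dv0 xv0.
exists v0; split=> // w evw; have [] // := key w _ (nv0 w evw).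
by apply/card_gt0P; exists v0; rewrite inE e_sym.
Qed.

End TestVector.

Lemma card_nbr v : #|nbr v| = deg e v. Proof. by []. Qed.

Lemma notin_nbr v : v \notin nbr v. Proof. by rewrite inE e_irr. Qed.

Lemma card_far v : deg e v + #|far v| + 1 = n.
Proof.
have := cardsC (v |: nbr v); rewrite card_ord cardsU1 notin_nbr -card_nbr /far; lia.
Qed.

Lemma degE w : deg e w = degin e setT w.
Proof. by rewrite degin_card; apply: eq_card => x; rewrite !inE. Qed.

Lemma disjoint_nbr_far v : [disjoint nbr v & far v].
Proof.
rewrite -setI_eq0; apply/eqP/setP => w; rewrite !inE.
by case: (e v w); rewrite ?orbT ?andbF.
Qed.

Lemma deg_split v w :
  deg e w = e v w + degin e (nbr v) w + degin e (far v) w.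
Proof.
rewrite degE -addnA -degin_disjointU ?disjoint_nbr_far //.
rewrite [e v w]e_sym -degin_setU1; last by rewrite !inE e_irr eqxx.
by congr degin; apply/setP => x; rewrite !inE; case: (x == v); case: (e v x).
Qed.

Lemma Qact_deg v :
  Qact (deg e) v = deg e v * deg e v + deg e v
    + \sum_(w in nbr v) degin e (nbr v) w + \sum_(w in nbr v) degin e (far v) w.
Proof.
rewrite /Qact -!addnA; congr (_ + _).
rewrite (eq_bigr (fun w => 1 + (degin e (nbr v) w + degin e (far v) w))) => [|w].
  by rewrite !big_split /= sum1_card.
by rewrite inE (deg_split v) => ->; rewrite addnA.
Qed.

Lemma nbr_path_cycle v s : 1 < size s -> upath e (nbr v) s ->
  has_cycle_of_length e (size s).+1.
Proof.
case: s => [|x s] // sz /and3P[us ss /allP Xs].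
have ev w : w \in x :: s -> e v w by move/Xs; rewrite inE.
have [|||cc uc] := @cone_cycle _ e e_sym v x s _ _ _ us ss.
- by rewrite ev ?mem_head.
- by rewrite ev ?mem_last.
- by apply/negP => /ev; rewrite e_irr.
by exists (v :: x :: s).
Qed.

(** The first two terms cancel those of [Qact_deg]; the last one is the number of possible edges
    between [nbr v] and [far v]. *)
Lemma bound_mul_deg k v : 0 < k ->
  (n + k.*2 - 2) * deg e v = deg e v * deg e v + deg e v
    + (k.*2 - 2) * deg e v + deg e v * #|far v|.
Proof.
move=> k_gt0; have -> : n + k.*2 - 2 = deg e v + 1 + (k.*2 - 2) + #|far v|.
  by have := card_far v; lia.
by rewrite !mulnDl mul1n [#|_| * _]mulnC.
Qed.

Lemma nbr_complete_far v :
  deg e v * #|far v| <= \sum_(w in nbr v) degin e (far v) w ->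
  forall u w, u \in nbr v -> w \in far v -> e u w.
Proof.
move=> full u w uU wW; apply: contraLR full => euw; rewrite -ltnNge.
rewrite (bigD1 u) //= -card_nbr (cardsD1 u) uU mulnDl mul1n -addSn leq_add //.
  rewrite degin_card; apply/proper_card/properP; split.
    by apply/subsetP => z; rewrite inE => /andP[].
  by exists w; rewrite // inE (negPf euw) andbF.
rewrite (eq_bigl [in nbr v :\ u]) => [|z]; last by rewrite !inE andbC.
by rewrite -sum_nat_const; apply: leq_sum => z _; apply: degin_le_card.
Qed.

(** Cycles of length [L] are tuples over a finite type, so arguing by contradiction is
    constructive. *)
Lemma has_cycle_dec L : has_cycle_of_length e L \/ ~ has_cycle_of_length e L.
Proof.
have [/existsP[t /andP[ct ut]]|nc] :=
    boolP [exists t : L.-tuple 'I_n, cycle e t && uniq t].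
  by left; exists t; rewrite size_tuple.
right=> -[s [cs us szs]]; case/existsP: nc; exists (tcast szs (in_tuple s)).
by rewrite val_tcast cs us.
Qed.

(** * Cycles of length [2k + 1] *)

Section OddCycle.

Variable k : nat.
Hypotheses (k_gt1 : 1 < k) (noC : ~ has_cycle_of_length e k.*2.+1).

Lemma sum_degin_nbr_odd v :
  \sum_(w in nbr v) degin e (nbr v) w <= (k.*2 - 2) * deg e v.
Proof.
apply: Erdos_Gallai_even => // s us; apply/negP => /eqP szs.
by apply: noC; rewrite -szs; apply: nbr_path_cycle us; lia.
Qed.

Lemma Qact_deg_odd v : Qact (deg e) v <= (n + k.*2 - 2) * deg e v.
Proof.
rewrite Qact_deg bound_mul_deg; last by lia.
have := sum_degin_nbr_odd v; have := sum_degin_le e (nbr v) (far v).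
by rewrite card_nbr; lia.
Qed.

(* Otherwise [nbr v] is completely joined to at least [k] vertices, and an edge
   inside [nbr v] closes an alternating path into a cycle of length [2k + 1]. *)
Lemma tight_odd_deg v :
  0 < deg e v -> Qact (deg e) v = (n + k.*2 - 2) * deg e v -> n < deg e v + k.
Proof.
move=> dv; rewrite Qact_deg bound_mul_deg => [eqQ|]; last by lia.
have le1 := sum_degin_nbr_odd v.
have le2 := sum_degin_le e (nbr v) (far v); rewrite card_nbr in le2.
have full : forall u w, u \in nbr v -> w \in far v -> e u w.
  by apply: nbr_complete_far; lia.
have eqE : \sum_(w in nbr v) degin e (nbr v) w = (k.*2 - 2) * deg e v by lia.
have dk : k.*2 - 1 <= deg e v.
  have : (k.*2 - 2) * deg e v <= (deg e v - 1) * deg e v.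
    rewrite -eqE mulnC -[X in X * _]card_nbr -sum_nat_const; apply: leq_sum => w wU.
    by have := degin_lt_card e_irr wU; rewrite card_nbr; lia.
  by rewrite leq_pmul2r; lia.
have /existsP[a /andP[aU /existsP[a' /andP[a'U eaa']]]] :
    [exists a, (a \in nbr v) && [exists a', (a' \in nbr v) && e a a']].
  apply: contraT => /existsPn no; move: eqE; rewrite big1.
    by move/esym/eqP; rewrite muln_eq0; lia.
  move=> w wU; rewrite /degin big1 // => z zU; move: (no w); rewrite wU /=.
  by move/existsPn/(_ z); rewrite zU; case: (e w z).
rewrite ltnNge; apply/negP => dkn.
have cB : #|v |: far v| = 1 + #|far v| by rewrite cardsU1 !inE eqxx.
(* [k + 1] vertices of [nbr v] alternate with [k] of [v |: far v], and the edge between [a'] and [a]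
   closes the cycle. *)
have [|||||||s [ps ls us szs _]] :=
    @complete_bipartite_path _ e e_sym k.-1 (nbr v) (v |: far v) a a'.
- rewrite -setI_eq0 setIUr; apply/eqP/setP => z; rewrite !inE.
  case: (eqVneq z v) => [->|_]; rewrite ?e_irr //.
  by case: (e v z); rewrite ?orbT ?andbF.
- move=> x z xU; rewrite in_setU1 => /orP[/eqP->|]; last exact: full.
  by rewrite e_sym; move: xU; rewrite inE.
- by [].
- by [].
- by apply: contraTneq eaa' => ->; rewrite e_irr.
- by rewrite card_nbr; lia.
- by rewrite cB; have := card_far v; lia.
apply: noC; exists (a :: s); split=> //; last by rewrite /= szs; lia.
by rewrite /= rcons_path ps ls e_sym.
Qed.

Lemma odd_cycle_bound (R : realFieldType) (q : R) : 6 * k < n ->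
  eigenvalue (signless_laplacian R e) q -> ((n + k.*2 - 2)%:R <= q)%R -> False.
Proof.
move=> nk qQ Nq.
have [||v _|v [dv tv tw]] := test_vector (y := deg e) qQ _ Nq.
- lia.
- by [].
- exact: Qact_deg_odd.
have dn := tight_odd_deg dv tv.
have le1 := sum_degin_nbr_odd v.
(* The neighbours of [v] are tight too. All these degrees exceed [n - k], so each neighbour has at
   least [2k - 1] neighbours inside [nbr v]. *)
suff : (k.*2 - 1) * deg e v <= \sum_(w in nbr v) degin e (nbr v) w.
  move=> le2; have := leq_trans le2 le1; rewrite leq_pmul2r //; lia.
rewrite mulnC -[X in X * _]card_nbr -sum_nat_const; apply: leq_sum => w.
rewrite inE => evw.
have dw : 0 < deg e w by apply/card_gt0P; exists v; rewrite inE e_sym.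
have := tight_odd_deg dw (tw w evw); rewrite (deg_split v) evw.
by have := degin_le_card e (far v) w; have := card_far v; lia.
Qed.

End OddCycle.

(** * Cycles of length [2k + 2] *)

Section EvenCycle.

Variable k : nat.
Hypotheses (k_gt1 : 1 < k) (n_gt : 12 * k < n).
Hypothesis noC : ~ has_cycle_of_length e k.*2.+2.

Lemma no_long_nbr_path v s : upath e (nbr v) s -> size s != k.*2.+1.
Proof.
move=> us; apply/negP => /eqP szs.
by apply: noC; rewrite -szs; apply: nbr_path_cycle us; lia.
Qed.

Lemma sum_degin_nbr_even v :
  \sum_(w in nbr v) degin e (nbr v) w <= (k.*2 - 1) * deg e v.
Proof. by apply: Erdos_Gallai_odd => // s; apply: no_long_nbr_path. Qed.

Lemma no_cone_path v x s : v \notin x :: s -> uniq (x :: s) -> path e x s ->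
  e v x -> e v (last x s) -> size s <> k.*2.
Proof.
move=> vs us ps evx evl szs; apply: noC.
have [cc uc] := cone_cycle e_sym evx evl vs us ps.
by exists (v :: x :: s); rewrite /= szs.
Qed.

(* A path ending in [w] can be shifted by one vertex, since [w] has a neighbour
   in [nbr v] off the path. *)
Lemma no_long_nbr_far_path v w s : w \in far v -> k.*2 < degin e (nbr v) w ->
  upath e (w |: nbr v) s -> size s != k.*2.+1.
Proof.
move=> wW dw us; apply/negP => /eqP szs.
have [wv wU] : w != v /\ w \notin nbr v by move: wW; rewrite !inE negb_or => /andP[].
have vX : v \notin w |: nbr v by rewrite !inE e_irr eq_sym (negPf wv).
have notv t : upath e (w |: nbr v) t -> v \notin t.
  by move=> /and3P[_ _ /allP Xt]; apply: contra vX => /Xt.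
have inU t x : upath e (w |: nbr v) t -> x \in t -> x != w -> e v x.
  by move=> /and3P[_ _ /allP Xt] /Xt; rewrite !inE => /orP[->|->].
have shift t : upath e (w |: nbr v) (w :: t) -> size t <> k.*2.
  move=> ut szt.
  have [z /andP[zU ewz] zt] : exists2 z, (z \in nbr v) && e w z & z \notin t.
    apply/exists_inP; apply: contraLR dw => /exists_inPn no.
    rewrite -leqNgt -szt degin_card.
    apply: leq_trans (card_size t); apply/subset_leq_card/subsetP => z.
    by rewrite inE => /no; rewrite negbK.
  have zw : z != w by apply: contraNneq wU => <-.
  move: ut szt zt; case/lastP: t => [|t y]; first by move=> _ /= ?; lia.
  rewrite size_rcons mem_rcons inE negb_or => ut szt /andP[_ zt].
  have {}ut : upath e (w |: nbr v) (w :: t).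
    by have := upath_take (size t).+1 ut; rewrite /= -cats1 take_size_cat.
  have {}ut : upath e (w |: nbr v) [:: z, w & t].
    apply: upath_cons => //; first by rewrite in_setU zU orbT.
      by rewrite inE negb_or zw.
    by rewrite e_sym.
  have [u1 s1 _] := and3P ut.
  apply: (no_cone_path (notv _ ut) u1 s1) _ _ _; last by rewrite /= -szt.
    by move: zU; rewrite inE.
  apply: inU (ut) _ _; rewrite ?mem_last //.
  move: u1 szt; case: (lastP t) => [|t' x]; first by move=> _ /= ?; lia.
  case/andP=> _ /andP[wt _] _; rewrite /= last_rcons.
  by apply: contraNneq wt => <-; rewrite mem_rcons mem_head.
case: s us szs => [|x p] //= us [szp].
have [xw|xw] := eqVneq x w; first by rewrite xw in us; apply: shift us szp.
have [lw|lw] := eqVneq (last x p) w.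
  move: us; rewrite -upath_rev // lastI rev_rcons lw => us.
  by apply: shift us _; rewrite size_rev size_belast.
have [u1 s1 _] := and3P us.
apply: (no_cone_path (notv _ us) u1 s1) szp; first exact: inU us (mem_head _ _) xw.
exact: inU us (mem_last _ _) lw.
Qed.

(** Erdős-Gallai on [w |: nbr v], where each edge from [w] to [nbr v] counts twice. *)
Lemma far_degin_bound v w : w \in far v -> k.*2 < degin e (nbr v) w ->
  \sum_(u in nbr v) degin e (nbr v) u + (degin e (nbr v) w).*2
    <= (k.*2 - 1) * deg e v + (k.*2 - 1).
Proof.
move=> wW dw; have wU : w \notin nbr v by move: wW; rewrite !inE negb_or => /andP[].
rewrite -sum_degin_setU1 // addnC -[X in X + _]muln1 -mulnDr.
have <- : #|w |: nbr v| = 1 + deg e v by rewrite cardsU1 wU.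
by apply: Erdos_Gallai_odd => // s; apply: no_long_nbr_far_path.
Qed.

(** With [d], [f], [E], [F] as in the proof, the hypothesis reads [(2k - 2) d + d f <= E + F]. As
    [E <= (2k - 1) d], at most [d] edges between [nbr v] and [far v] are missing. *)
Lemma tight_even v : 0 < deg e v -> (n + k.*2 - 2) * deg e v <= Qact (deg e) v ->
  #|far v| <= 1 /\ forall w, w \in far v -> deg e w <= k.*2.
Proof.
move=> dv; rewrite Qact_deg bound_mul_deg; last by lia.
set d := deg e v in dv *; set f := #|far v|.
set E := \sum_(w in _) degin e (nbr v) w.
rewrite exchange_degin //; set F := \sum_(w in _) _ => tight.
have dfn : d + f + 1 = n := card_far v.
have leE : E <= (k.*2 - 2) * d + d.
  have -> : (k.*2 - 2) * d + d = (k.*2 - 1) * d by rewrite -mulSnr; congr (_ * _); lia.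
  exact: sum_degin_nbr_even.
have leE2 : E <= d * (d - 1).
  rewrite -sum_nat_const; apply: leq_sum => w wU.
  by have := degin_lt_card e_irr wU; rewrite card_nbr -/d; lia.
have deg_le w : degin e (nbr v) w <= d by exact: degin_le_card.
have leF : F <= d * f.
  by rewrite mulnC -sum_nat_const; apply: leq_sum => w _.
(* [F <= d f] leaves [(2k - 2) d <= E <= d (d - 1)], impossible for [d <= k]. *)
have [dk|kd] := leqP d k.
  have : (k.*2 - 2) * d <= d * (d - 1) by lia.
  by rewrite mulnC leq_pmul2l //; lia.
have f_le1 : f <= 1.
  rewrite leqNgt; apply/negP => f_gt1.
  have [d4|d4] := leqP d (4 * k + 1).
    (* At least [f - d >= k] far vertices are joined to all of [nbr v], since [n > 12k]; an
       alternating path on [2k + 1] vertices then closes through [v]. *)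
    pose B := [set b in far v | d <= degin e (nbr v) b].
    have BW : B \subset far v by apply/subsetP => b; rewrite inE => /andP[].
    have cB : F + #|far v :\: B| <= d * f.
      have -> : #|far v :\: B| = \sum_(b in far v) (b \notin B).
        rewrite -sum1_card big_mkcond [RHS]big_mkcond /=; apply: eq_bigr => b _.
        by rewrite in_setD andbC; case: (b \in far v); case: (b \in B).
      rewrite -big_split mulnC -sum_nat_const /=; apply: leq_sum => b bW.
      by have := deg_le b; rewrite inE bW /=; case: leqP => /=; lia.
    have cB2 : #|B| + #|far v :\: B| = f.
      by rewrite /f -(cardsID B (far v)) (setIidPr BW).
    have /card_gt1P[a [a' [aU a'U aa']]] : 1 < #|nbr v| by rewrite card_nbr -/d; lia.
    have [|||||||s [ps ls us szs sub]] :=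
        @complete_bipartite_path _ e e_sym k.-1 (nbr v) B a a' => //.
    - rewrite disjoint_sym; apply: disjointWl BW _.
      by rewrite disjoint_sym disjoint_nbr_far.
    - move=> x b xU; rewrite inE => /andP[_ db]; rewrite e_sym.
      exact: (degin_full db).
    - by rewrite card_nbr -/d; lia.
    - by lia.
    have vs : v \notin a :: s.
      apply/negP => /sub; rewrite in_setU (negPf (notin_nbr v)) /=.
      by move/(subsetP BW); rewrite !inE eqxx.
    apply: (no_cone_path vs us ps); rewrite ?ls ?szs; last by lia.
      by move: aU; rewrite inE.
    by move: a'U; rewrite inE.
  (* The degrees of two far vertices into [nbr v] sum to at least [d > 4k + 1], so the larger one
     exceeds [2k] and contradicts [far_degin_bound]. *)
  have /card_gt1P[w1 [w2 [w1W w2W w12]]] := f_gt1.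
  have F12 : F <= degin e (nbr v) w1 + degin e (nbr v) w2 + d * (f - 2).
    rewrite /F (bigD1 w1) //= (bigD1 w2) /=; last by rewrite w2W eq_sym.
    rewrite addnA leq_add2l (eq_bigl [in far v :\ w1 :\ w2]) => [|b]; last first.
      by rewrite !in_setD1; case: (b \in far v); case: (b == w1); case: (b == w2).
    have -> : f - 2 = #|far v :\ w1 :\ w2|.
      rewrite /f (cardsD1 w1) w1W (cardsD1 w2 (far v :\ w1)) !in_setD1.
      by rewrite w2W eq_sym w12; lia.
    by rewrite mulnC -sum_nat_const; apply: leq_sum => b _.
  have df : d * f = d * (f - 2) + d * 2 by rewrite -mulnDr; congr (_ * _); lia.
  have : exists2 w, w \in far v & d <= (degin e (nbr v) w).*2 /\
      degin e (nbr v) w1 + degin e (nbr v) w2 <= (degin e (nbr v) w).*2.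
    have [le|lt] := leqP (degin e (nbr v) w1) (degin e (nbr v) w2).
      by exists w2; rewrite // -addnn; split; lia.
    by exists w1; rewrite // -addnn; split; lia.
  case=> w wW [dw1 dw2].
  have := far_degin_bound wW; rewrite -/E -/d.
  have -> : (k.*2 - 1) * d = (k.*2 - 2) * d + d by rewrite -mulSnr; congr (_ * _); lia.
  lia.
(* Now [f = 1] and tightness reads [(2k - 1) d <= E + deg e w]; for [deg e w > 2k],
   [far_degin_bound] would give [deg e w <= 2k - 1]. *)
split=> // w wW; rewrite leqNgt; apply/negP => dw.
have farE : far v = [set w].
  by apply/esym/eqP; rewrite eqEcard cards1 f_le1 andbT sub1set.
have Fw : F = degin e (nbr v) w by rewrite /F farE big_set1.
have fw : f = 1 by rewrite /f farE cards1.
have degw : deg e w = degin e (nbr v) w.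
  have evw : e v w = false by move: wW; rewrite !inE negb_or => /andP[_ /negPf].
  by rewrite (deg_split v) evw farE /degin big_set1 e_irr addn0.
have := far_degin_bound wW; rewrite -/E -/d -degw.
have -> : (k.*2 - 1) * d = (k.*2 - 2) * d + d by rewrite -mulSnr; congr (_ * _); lia.
rewrite fw muln1 in tight.
lia.
Qed.

(** * Modified weights around a heavy vertex *)

Section HeavyVertex.

Variables (u : 'I_n) (S : {set 'I_n}).
Hypotheses (heavy : (n + k.*2 - 2) * deg e u < Qact (deg e) u)
  (SU : S \subset nbr u) (clS : closed_in e (nbr u) S)
  (dS : forall v, v \in S -> degin e S v < k.*2)
  (pS : forall v, v \in S -> starts_path e S v k.*2)
  (eS : \sum_(v in nbr u :\: S) degin e (nbr u :\: S) v
          <= (k.*2 - 2) * #|nbr u :\: S|).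

(* On the dense components of [nbr u] the degrees overestimate the eigenvector
   grossly; the constant weight [2] is enough there. *)
Let y v := if v \in S then 2 else deg e v.

Lemma heavy_far : #|far u| <= 1 /\ forall w, w \in far u -> deg e w <= k.*2.
Proof.
apply: tight_even (ltnW heavy); rewrite lt0n; apply: contraTneq heavy => d0.
by rewrite Qact_deg d0 /nbr (cards0_eq d0) !big_set0.
Qed.

(** If [S] were empty, [eS] would be the bound [2k - 2] on the average inner degree and [u] would
    not be heavy. *)
Lemma card_dense : 1 < #|S|.
Proof.
have [S0|/set0Pn[v vS]] := eqVneq S set0; last first.
  have [s [us szs]] := pS vS; have := upath_size us; rewrite szs; apply: leq_trans; lia.
have [far1 _] := heavy_far; have := heavy; move: eS; rewrite S0 setD0 card_nbr.
rewrite Qact_deg bound_mul_deg; last by lia.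
by have := sum_degin_le e (nbr u) (far u); rewrite card_nbr; lia.
Qed.

(** Each vertex of [S] contributes [2 <= 2k - 2], without the extra [1] for its edge to [u]; as [S]
    is nonempty, this makes the inequality strict. *)
Lemma Qact_center : Qact y u < (n + k.*2 - 2) * y u.
Proof.
have uS : u \notin S by apply: contra (notin_nbr u) => /(subsetP SU).
have yu : y u = deg e u by rewrite /y (negPf uS).
rewrite /Qact yu bound_mul_deg; last by lia.
rewrite (big_setID S) /= (setIidPr SU).
rewrite (eq_bigr (fun=> 2)) => [|v vS]; last by rewrite /y vS.
pose g v := 1 + (degin e (nbr u :\: S) v + degin e (far u) v).
rewrite sum_nat_const [X in _ + (_ + X)](eq_bigr g); last first.
  move=> v; rewrite /g inE => /andP[vS vU]; rewrite /y (negPf vS) (deg_split u).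
  rewrite (degin_setD _ _ SU) (degin_closed0 e_sym clS vU vS) add0n.
  by move: vU; rewrite inE => ->; rewrite addnA.
rewrite !big_split /= sum1_card.
have sub := sum_degin_le e (nbr u :\: S) (far u).
have : #|nbr u :\: S| * #|far u| <= deg e u * #|far u|.
  by rewrite leq_mul2r (subset_leq_card (subsetDl _ _)) orbT.
have dE : deg e u = #|S| + #|nbr u :\: S|.
  by rewrite -card_nbr -(cardsID S (nbr u)) (setIidPr SU).
have -> : (k.*2 - 2) * deg e u = (k.*2 - 2) * #|S| + (k.*2 - 2) * #|nbr u :\: S|.
  by rewrite dE mulnDr.
have : 2 * #|S| <= (k.*2 - 2) * #|S| by rewrite leq_mul2r; apply/orP; right; lia.
have := card_dense; move: eS sub dE; set D := nbr u :\: S.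
move: (\sum_(i in D) degin e (far u) i) (\sum_(i in D) degin e D i) => F E.
move: (deg e u * deg e u) (deg e u * #|far u|) (#|D| * #|far u|) => a b c.
move: ((k.*2 - 2) * #|S|) ((k.*2 - 2) * #|D|) (deg e u) => a' b' d.
move: #|S| #|D| => *; lia.
Qed.

Lemma Qact_dense v : v \in S -> Qact y v < (n + k.*2 - 2) * y v.
Proof.
move=> vS; have vU := subsetP SU v vS; have [far1 farD] := heavy_far.
have degv : deg e v <= k.*2 + 1.
  rewrite (deg_split u) (degin_setD _ _ SU).
  rewrite [degin e (_ :\: _) v](degin_closed0 e_sym (closed_in_setD e_sym clS)) //;
    last by rewrite inE vS.
  move: far1 (dS vS) (degin_le_card e (far u) v).
  by move: (degin e S v) (degin e (far u) v) #|far u| => a b c; case: (e u v); lia.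
(* Only [u] and at most one far vertex can weigh more than [2], by at most [n] and [2k], whereas the
   target contains [n] twice. *)
have yle w : w \in nbr v -> y w <= 2 + (w == u) * n + (w \in far u) * k.*2.
  rewrite inE => evw; rewrite /y; case: ifP => wS; first by rewrite -addnA leq_addr.
  have [->|wu] := eqVneq w u.
    by have := card_far u; lia.
  have [wW|wW] := boolP (w \in far u); first by have := farD w wW; lia.
  suff : w \in S by rewrite wS.
  apply: clS vS _ evw; move: wW; rewrite in_setC negbK in_setU1 (negPf wu).
  by [].
have sum_sub (g : 'I_n -> nat) : \sum_(w in nbr v) g w <= \sum_w g w.
  by rewrite big_mkcond; apply: leq_sum => w _; case: ifP.
have : \sum_(w in nbr v) y w <= 2 * deg e v + n + k.*2.
  apply: leq_trans (leq_sum _ yle) _; rewrite !big_split /=.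
  apply: leq_add; first apply: leq_add.
  - by rewrite sum_nat_const card_nbr mulnC.
  - apply: leq_trans (sum_sub _) _; rewrite (bigD1 u) //= eqxx mul1n big1 ?addn0 //.
    by move=> w /negPf->.
  - apply: leq_trans (sum_sub _) _; rewrite -big_distrl /= -big_mkcond /=.
    rewrite sum1_card; have := leq_mul far1 (leqnn k.*2); lia.
have yv : y v = 2 by rewrite /y vS.
by rewrite /Qact yv; lia.
Qed.

(** The weights around [v] are degrees, as [v] has no neighbour in [S]. Tightness would leave [v] at
    most one non-neighbour, but [S] supplies two. *)
Lemma Qact_sparse v : v \in nbr u -> v \notin S -> Qact y v < (n + k.*2 - 2) * y v.
Proof.
move=> vU vS; have yv : y v = deg e v by rewrite /y (negPf vS).
have vSN w : w \in S -> ~~ e v w.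
  by move=> wS; apply: contra vS => evw; apply: clS wS vU _; rewrite e_sym.
have -> : Qact y v = Qact (deg e) v.
  rewrite /Qact yv; congr (_ + _); apply: eq_bigr => w; rewrite inE /y => evw.
  by case: ifP => // /vSN; rewrite evw.
have dv : 0 < deg e v.
  by apply/card_gt0P; exists u; rewrite inE e_sym; move: vU; rewrite inE.
rewrite yv ltnNge; apply/negP => /(tight_even dv)[far1 _].
have : #|S| <= #|far v|.
  apply/subset_leq_card/subsetP => w wS; rewrite !inE negb_or vSN // andbT.
  by apply: contraNneq vS => <-.
by have := card_dense; lia.
Qed.

Lemma Qact_far v : 0 < deg e v -> v \in far u -> Qact y v < (n + k.*2 - 2) * y v.
Proof.
move=> dv vW; have [far1 farD] := heavy_far.
have [vu vU] : v != u /\ v \notin nbr u by move: vW; rewrite !inE negb_or => /andP[].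
have vS : v \notin S by apply: contra vU => /(subsetP SU).
have yv : y v = deg e v by rewrite /y (negPf vS).
(* A vertex of [S] adjacent to [v] has degree at least [2], from [u] and [v], so its weight did not
   grow. *)
apply: (@leq_ltn_trans (Qact (deg e) v)).
  rewrite /Qact yv leq_add2l; apply: leq_sum => w; rewrite inE /y => evw.
  case: ifP => // /(subsetP SU); rewrite inE => euw.
  rewrite (deg_split u) euw -addnA add1n ltnS addn_gt0; apply/orP; right.
  by rewrite degin_card; apply/card_gt0P; exists v; rewrite inE vW e_sym.
rewrite yv ltnNge; apply/negP => /(tight_even dv)[farv _].
by have := farD v vW; have := card_far v; lia.
Qed.

Lemma Qact_weights v : 0 < deg e v -> Qact y v < (n + k.*2 - 2) * y v.
Proof.
move=> dv; have [->|vu] := eqVneq v u; first exact: Qact_center.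
have [vS|vS] := boolP (v \in S); first exact: Qact_dense.
have [vU|vU] := boolP (v \in nbr u); first exact: Qact_sparse.
by apply: Qact_far; rewrite // in_setC in_setU1 negb_or vu.
Qed.

Lemma heavy_eigenvalue (R : realFieldType) (q : R) :
  eigenvalue (signless_laplacian R e) q -> ((n + k.*2 - 2)%:R <= q)%R -> False.
Proof.
move=> qQ Nq; have [|v dv|v dv|v [dv tv _]] := test_vector (y := y) qQ _ Nq.
- by lia.
- by rewrite /y; case: ifP.
- exact/ltnW/Qact_weights.
by have := Qact_weights dv; rewrite tv ltnn.
Qed.

End HeavyVertex.

Lemma even_cycle_bound (R : realFieldType) (q : R) :
  eigenvalue (signless_laplacian R e) q -> ((n + k.*2 - 2)%:R <= q)%R -> False.
Proof.
move=> qQ Nq.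
have [/existsP[u heavy]|/existsPn light] :=
    boolP [exists u, (n + k.*2 - 2) * deg e u < Qact (deg e) u].
  have [s|S [SU clS dS pS eS]] := path_free_partition e_sym e_irr (X := nbr u) k_gt1.
    exact: no_long_nbr_path.
  exact: heavy_eigenvalue heavy SU clS dS pS eS _ _ qQ Nq.
have [|||v [dv tv tw]] := test_vector (y := deg e) qQ _ Nq => //.
- by lia.
- by move=> v _; rewrite leqNgt light.
have far1 w : 0 < deg e w -> Qact (deg e) w = (n + k.*2 - 2) * deg e w -> #|far w| <= 1.
  by move=> dw tw'; have [] := tight_even dw; rewrite ?tw'.
(* By tightness [v] and each neighbour [w] have at most one non-neighbour, so at least [n - 4 >= 2k]
   neighbours of [w] lie in [nbr v]. *)
have : k.*2 * deg e v <= \sum_(w in nbr v) degin e (nbr v) w.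
  rewrite mulnC -[X in X * _]card_nbr -sum_nat_const; apply: leq_sum => w.
  rewrite inE => evw.
  have dw : 0 < deg e w by apply/card_gt0P; exists v; rewrite inE e_sym.
  have := far1 w dw (tw w evw); have := far1 v dv tv.
  have := card_far w; have := degin_le_card e (far v) w.
  by rewrite (deg_split v w) evw; lia.
move=> le1; have := leq_trans le1 (sum_degin_nbr_even v).
by rewrite leq_pmul2r //; lia.
Qed.

End EvenCycle.

End SignlessLaplacian.

Local Open Scope ring_scope.

Theorem theorem1 (R : rcfType) (k n : nat) (e : rel 'I_n) :
  (2 <= k)%N -> (6 * k ^ 2 < n)%N -> simple_graph e ->
  forall q : R, largest_eigenvalue (signless_laplacian R e) q ->
  (n + 2 * k - 2)%:R <= q ->
  has_cycle_of_length e (2 * k + 1) /\ has_cycle_of_length e (2 * k + 2).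
Proof.
move=> k_gt1 nk [e_sym e_irr] q [qQ _].
rewrite mul2n addn1 addn2 => Nq.
have n12 : (12 * k < n)%N.
  apply: leq_ltn_trans nk; rewrite expnS expn1 mulnA leq_mul2r.
  by apply/orP; right; lia.
split.
  have [//|noC] := has_cycle_dec e k.*2.+1.
  by case: (odd_cycle_bound e_sym e_irr k_gt1 noC _ qQ Nq); lia.
have [//|noC] := has_cycle_dec e k.*2.+2.
by case: (even_cycle_bound e_sym e_irr k_gt1 n12 noC qQ Nq).
Qed.
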